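(* Let $p$ be a prime and let $(A,+,\cdot)$ be a pre-Lie algebra over $\mathbb{F}_p$ with $(A,+)\cong C_p^5$, generated by two elements $x$ and $y$ (and by no fewer elements) as a pre-Lie algebra. Assume $A^{[3]}\neq 0$, $A^{[4]}=0$ and $\dim_{\mathbb{F}_p}A^{[3]}=2$. Put $S=\{x\cdot x,\ x\cdot y,\ y\cdot x,\ y\cdot y\}$. Then the following hold. (1) Not all elements of $S$ are in $A^{[3]}$. (2) $A$ has an $\mathbb{F}_p$-basis $\{x,y,u,v,w\}$ where $u\in S\setminus A^{[3]}$ and each of $v,w$ is a product of two factors, one factor being in $\{x,y\}$ and the other factor being $u$. (3) $A^{[3]}=\mathbb{F}_pv+\mathbb{F}_pw$ and $A^{[2]}/A^{[3]}=\mathbb{F}_pu$. (4) For $i,j\in\{x,y\}$ write $i\cdot j=\alpha_{ij}u+\beta_{ij}v+\gamma_{ij}w$ with $\alpha_{ij},\beta_{ij},\gamma_{ij}\in\mathbb{F}_p$; then not all $\alpha_{ij}$ are $0$. For $(k,l)$ with $k=u$, $l\in\{x,y\}$ or $k\in\{x,y\}$, $l=u$, write $k\cdot l=\delta_{kl}v+\nu_{kl}w$ with $\delta_{kl},\nu_{kl}\in\mathbb{F}_p$. Then $$\alpha_{xy}\delta_{ux}-\alpha_{yx}\delta_{xu}=\alpha_{yx}\delta_{ux}-\alpha_{xx}\delta_{yu},$$ $$\alpha_{xy}\nu_{ux}-\alpha_{yx}\nu_{xu}=\alpha_{yx}\nu_{ux}-\alpha_{xx}\nu_{yu},$$ $$\alpha_{yx}\delta_{uy}-\alpha_{xy}\delta_{yu}=\alpha_{xy}\delta_{uy}-\alpha_{yy}\delta_{xu},$$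 $$\alpha_{yx}\nu_{uy}-\alpha_{xy}\nu_{yu}=\alpha_{xy}\nu_{uy}-\alpha_{yy}\nu_{xu}.$$ (5) Conversely, if $A$ is a five-dimensional $\mathbb{F}_p$-vector space with a bilinear product (not assumed to be pre-Lie) generated by $x,y$, with $A^{[3]}\ne0$, $A^{[4]}=0$, $\dim_{\mathbb{F}_p}A^{[3]}=2$, and satisfying (1)–(4), then $A$ is a well defined pre-Lie algebra.
   Context: A pre-Lie algebra over $\mathbb{F}_p$ is an $\mathbb{F}_p$-vector space $A$ with a bilinear product $\cdot$ satisfying $(a\cdot b)\cdot c-a\cdot(b\cdot c)=(b\cdot a)\cdot c-b\cdot(a\cdot c)$ for all $a,b,c\in A$. For subspaces $B,C\subseteq A$, $B\cdot C$ denotes the subspace spanned by all $b\cdot c$ with $b\in B$, $c\in C$. Define (for any bilinear product) $A^{[1]}=A$ and $A^{[i+1]}=\sum_{j=1}^{i}A^{[j]}\cdot A^{[i+1-j]}$ for $i\ge 1$. $A^{[2]}/A^{[3]}=\mathbb{F}_pu$ means the quotient is spanned by the image of $u$. *)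

(* Defs.v *)
From mathcomp Require Import all_boot all_algebra.

Set Implicit Arguments.
Unset Strict Implicit.
Unset Printing Implicit Defensive.

Import GRing.Theory.
Local Open Scope ring_scope.

Section Algebra.
Variables (F : fieldType) (A : vectType F) (mul : {bilinear A -> A -> A}).
Implicit Types (U V W : {vspace A}) (x y u v w : A) (s : seq A).

Local Notation "a ⋅ b" := (mul a b) (at level 40, left associativity).

Definition pre_lie : Prop :=
  forall a b c, (a ⋅ b) ⋅ c - a ⋅ (b ⋅ c) = (b ⋅ a) ⋅ c - b ⋅ (a ⋅ c).

(* As for falgebra's prodv, products of basis vectors suffice; [prodsP] shows
   that this is the span of all products. *)
Definition prods U V : {vspace A} :=
  <<[seq b ⋅ c | b <- vbasis U, c <- vbasis V]>>%VS.

Lemma memv_prods U V b c : b \in U -> c \in V -> b ⋅ c \in prods U V.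
Proof.
move=> Ub Vc; rewrite (coord_vbasis Ub) (coord_vbasis Vc) linear_sumlz.
apply: memv_suml => i _; rewrite linear_sumr; apply: memv_suml => j _.
rewrite linearZl_LR linearZr_LR !memvZ // memv_span //.
by apply: (@allpairs_f _ _ _ mul); rewrite memt_nth.
Qed.

Lemma prodsP U V W :
  reflect (forall b c, b \in U -> c \in V -> b ⋅ c \in W) (prods U V <= W)%VS.
Proof.
apply: (iffP idP) => [sW b c Ub Vc | sW].
  exact: (subvP sW) (memv_prods Ub Vc).
by apply/span_subvP => _ /allpairsP[[b c] [/= Ub Vc ->]]; rewrite sW ?vbasis_mem.
Qed.

(* The list [:: A^[1]; ...; A^[n]]: strong recursion on the length. *)
Fixpoint powers (n : nat) : seq {vspace A} :=
  if n is m.+1 then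
    let P := powers m in
    rcons P (if m is 0 then fullv
             else (\sum_(j < m)
                     prods (nth fullv P j) (nth fullv P (m.-1 - j)))%VS)
  else [::].

(* A^[i] for i >= 1; the value at i = 0 is junk. *)
Definition power (i : nat) : {vspace A} := nth fullv (powers i) i.-1.

Lemma size_powers n : size (powers n) = n.
Proof. by elim: n => //= n IHn; rewrite size_rcons IHn. Qed.

Lemma nth_powers n i : (i < n)%N -> nth fullv (powers n) i = power i.+1.
Proof.
elim: n => // n IHn; rewrite ltnS leq_eqVlt => /predU1P[-> // | lt_in].
by rewrite [powers _]/= nth_rcons size_powers lt_in IHn.
Qed.

Lemma power1 : power 1 = fullv. Proof. by []. Qed.

Lemma powerS i : (0 < i)%N ->
  power i.+1 =
    (\sum_(1 <= j < i.+1) prods (power j) (power (i.+1 - j)))%VS.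
Proof.
case: i => // m _; rewrite [LHS]/power /=; set P := rcons (powers m) _.
have sP : size P = m.+1 by rewrite size_rcons size_powers.
have nthP j : (j < m.+1)%N -> nth fullv P j = power j.+1 by apply: (@nth_powers m.+1).
rewrite nth_rcons sP ltnn eqxx big_add1 big_mkord; apply: eq_bigr => j _.
have le_jm : (j <= m)%N by rewrite -ltnS.
by rewrite !nthP ?ltnS ?leq_subr // -subSn.
Qed.

Definition generates s : Prop :=
  forall U, {subset s <= U} ->
    (forall a b, a \in U -> b \in U -> a ⋅ b \in U) -> U = fullv.

Definition gen_products x y : seq A := [:: x ⋅ x; x ⋅ y; y ⋅ x; y ⋅ y].

Definition products_not_in_power3 x y : Prop := ~ {subset gen_products x y <= power 3}.

Definition adapted_basis x y u v w : Prop :=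
  [/\ basis_of fullv [:: x; y; u; v; w],
      u \in gen_products x y, u \notin power 3,
      v \in [:: x ⋅ u; y ⋅ u; u ⋅ x; u ⋅ y]
    & w \in [:: x ⋅ u; y ⋅ u; u ⋅ x; u ⋅ y]].

(* The second equation says that A^[2] / A^[3] is spanned by the image of u. *)
Definition power_spans u v w : Prop :=
  power 3 = (<[v]> + <[w]>)%VS /\ power 2 = (<[u]> + power 3)%VS.

(* The coefficients are indexed by the factors themselves; only their values on
   the relevant pairs of elements of {x, y, u} matter. *)
Definition structure_constants x y u v w
    (alpha beta gamma delta nu : A -> A -> F) : Prop :=
  (forall i j, i \in [:: x; y] -> j \in [:: x; y] ->
     i ⋅ j = alpha i j *: u + beta i j *: v + gamma i j *: w) /\
  (forall k l, k = u /\ l \in [:: x; y] \/ k \in [:: x; y] /\ l = u ->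
     k ⋅ l = delta k l *: v + nu k l *: w).

Definition structure_relations x y u v w : Prop :=
  (exists alpha beta gamma delta nu,
     structure_constants x y u v w alpha beta gamma delta nu) /\
  forall alpha beta gamma delta nu,
    structure_constants x y u v w alpha beta gamma delta nu ->
  [/\ ~ (forall i j, i \in [:: x; y] -> j \in [:: x; y] -> alpha i j = 0),
      alpha x y * delta u x - alpha y x * delta x u
        = alpha y x * delta u x - alpha x x * delta y u,
      alpha x y * nu u x - alpha y x * nu x u
        = alpha y x * nu u x - alpha x x * nu y u,
      alpha y x * delta u y - alpha x y * delta y u
        = alpha x y * delta u y - alpha y y * delta x u
    & alpha y x * nu u y - alpha x y * nu y u
        = alpha x y * nu u y - alpha y y * nu x u].

End Algebra.

(* Main.v *)
Require Import Defs.
From mathcomp Require Import all_boot all_algebra.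
Import GRing.Theory.
Local Open Scope ring_scope.

(** The filtration A^[1], A^[2], ... behaves like the lower central series of a
nilpotent group.  It is decreasing and multiplicative, so A^[4] = 0 kills every
product of total weight at least 4, and a Frattini argument holds: elements
generate A as soon as they span A modulo A^[2] (generates_of_span_add_power2).
Hence a minimal generating sequence is a basis of A modulo A^[2] (dim_power2),
and dim A = 5, dim A^[3] = 2 with two generators leave exactly one dimension
for A^[2] / A^[3].

Each layer is spanned, modulo the next, by products of spanning sets of the
lower layers: A^[2] = <S> + A^[3], so some u in S lies outside A^[3] and spans
A^[2] / A^[3]; then A^[3] is spanned by xu, yu, ux, uy, since A^[4] = 0, and two
of these form a basis of it.  This gives parts (1) to (3).

For part (4) and its converse, the associator (ab)c - a(bc) is trilinear and, by
weight, vanishes as soon as one argument is in A^[2].  So A is pre-Lie if and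
only if the associator is symmetric in its first two arguments when all three are
taken among x and y (pre_lie_of_generators).  Symmetry is trivial when the first
two arguments agree, so only the two cases (xy)x - x(yx) = (yx)x - y(xx) and
(yx)y - y(xy) = (xy)y - x(yy) are left.  In an associator of x and y only the u
component of the inner product survives, and comparing coordinates on the basis
v, w of A^[3] turns these two vector equations into the four scalar ones
(associator_symP).  Both directions of the theorem rest on this equivalence. *)

(** * Spanning sets and independence modulo a subspace *)

Section VectorSpaces.
Set Implicit Arguments.
Unset Strict Implicit.
Variables (F : fieldType) (A : vectType F).
Implicit Types (U V W : {vspace A}) (v w : A) (s t : seq A).

Lemma dim_line_add U v : v \notin U -> \dim (<[v]> + U) = (\dim U).+1.
Proof.
move=> Uv; rewrite dimv_disjoint_sum ?dim_vline.
  by have -> : v != 0 by apply: contraNneq Uv => ->; rewrite mem0v.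
apply/eqP; rewrite -subv0; apply/subvP => a /memv_capP[/vlineP[k ->] Uk].
have [-> | k0] := eqVneq k 0; first by rewrite scale0r mem0v.
by case/negP: Uv; rewrite -[v](scalerK k0) memvZ.
Qed.

(** Sifting a list modulo U.  With U = A^[2] it shows that minimal generating
sequences are independent modulo A^[2]; with U = 0 it finds v and w among the
products that span A^[3]. *)
Lemma independent_sublist U s :
  exists t, [/\ {subset t <= s}, (size t <= size s)%N,
                (<<t>> + U = <<s>> + U)%VS
              & \dim (<<t>> + U) = (size t + \dim U)%N].
Proof.
elim: s => [|v s [t [sub_ts le_ts eq_ts dim_t]]].
  by exists [::]; split=> //; rewrite span_nil add0v.
have [tUv | tUv] := boolP (v \in (<<t>> + U)%VS).
  exists t; split=> //; last 1 first.
  - by rewrite span_cons -addvA -eq_ts; apply/esym/addv_idPr; rewrite -memvE.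
  - by move=> a /sub_ts; rewrite inE orbC => ->.
  - exact: leqW.
exists (v :: t); split.
- move=> a; rewrite !inE => /orP[-> // | /sub_ts ->]; exact: orbT.
- by rewrite /= ltnS.
- by rewrite !span_cons -!addvA eq_ts.
by rewrite span_cons -addvA dim_line_add //= dim_t.
Qed.

Lemma free_pair_inj v w (a b c d : F) : free [:: v; w] ->
  a *: v + b *: w = c *: v + d *: w -> a = c /\ b = d.
Proof.
move=> /(freeP (X := [tuple v; w])) fr /eqP.
rewrite -subr_eq0 opprD addrACA -!scalerBl => /eqP eq0.
have k0 := fr (fun i : 'I_2 => [:: a - c; b - d]`_i).
have {}k0 i : [:: a - c; b - d]`_(i : 'I_2) = 0.
  by apply: k0; rewrite !big_ord_recl big_ord0 addr0.
by split; apply/eqP; rewrite -subr_eq0; apply/eqP;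
  [apply: (k0 ord0) | apply: (k0 (Ordinal (isT : (1 < 2)%N)))].
Qed.

(** Induction principle that extends a multilinear identity, one argument at a
time, from a spanning list and a subspace to their sum. *)
Lemma span_add_ind s U (P : A -> Prop) :
    (forall k a b, P a -> P b -> P (k *: a + b)) ->
    (forall a, a \in s -> P a) -> (forall a, a \in U -> P a) ->
  forall a, a \in (<<s>> + U)%VS -> P a.
Proof.
move=> Plin Ps PU _ /memv_addP[a sa [b /PU Pb ->]].
rewrite (coord_span (X := in_tuple s) sa).
elim/big_rec: _ => [|i c _ Pc]; first by rewrite add0r.
by rewrite -addrA; apply: Plin; [apply: Ps; rewrite mem_nth | ].
Qed.

End VectorSpaces.

(** * The power filtration of a nonassociative algebra *)

Section Algebra.
Set Implicit Arguments.
Unset Strict Implicit.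
Variables (F : fieldType) (A : vectType F) (mul : {bilinear A -> A -> A}).
Implicit Types (U V W : {vspace A}) (a b c x y u v w : A) (s t : seq A).

Local Notation "a ⋅ b" := (mul a b) (at level 40, left associativity).

Lemma prods_span s t : prods mul <<s>> <<t>> = <<[seq b ⋅ c | b <- s, c <- t]>>%VS.
Proof.
apply/eqP; rewrite eqEsubv; apply/andP; split.
  apply/prodsP => b c sb tc.
  rewrite (coord_span (X := in_tuple s) sb) (coord_span (X := in_tuple t) tc).
  rewrite linear_sumlz; apply: memv_suml => i _.
  rewrite linear_sumr; apply: memv_suml => j _.
  rewrite linearZl_LR linearZr_LR !memvZ // memv_span //.
  by apply: (@allpairs_f _ _ _ mul); rewrite mem_nth.
apply/span_subvP => _ /allpairsP[[b c] [/= sb tc ->]].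
by apply: memv_prods; apply: memv_span.
Qed.

Lemma mem_power_mul i j a b : (0 < i)%N -> (0 < j)%N ->
  a \in power mul i -> b \in power mul j -> a ⋅ b \in power mul (i + j).
Proof.
case: i j => // i [//|j] _ _ Aa Ab; rewrite addSn powerS ?addnS // big_add1 big_mkord.
have lti : (i < (i + j).+1)%N by rewrite ltnS leq_addr.
apply: (subvP (sumv_sup (Ordinal lti) isT (subvv _))).
by apply: memv_prods => //=; rewrite subSS -addnS addKn.
Qed.

(** Elimination rule for powers, which hides the indexed sum that defines them:
A^[n] is the smallest subspace containing all products of total weight n. *)
Lemma power_sub n W : (1 < n)%N ->
  (forall i j a b, (0 < i)%N -> (0 < j)%N -> (i + j)%N = n ->
     a \in power mul i -> b \in power mul j -> a ⋅ b \in W) ->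
  (power mul n <= W)%VS.
Proof.
case: n => // n n0 sub; rewrite powerS // big_nat.
elim/big_rec: _ => [|i U /andP[i0 lin] UW]; first exact: sub0v.
rewrite subv_add UW andbT; apply/prodsP => a b; apply: sub => //.
  by rewrite subn_gt0.
by rewrite subnKC // ltnW.
Qed.

(** When n > 1, a product of weight n + 1 has a factor of weight at least 2; by
induction that factor also has the weight below, so the product has weight n. *)
Lemma powerS_sub n : (power mul n.+1 <= power mul n)%VS.
Proof.
elim/ltn_ind: n => -[|[|n]] IHn; try exact: subvf.
apply: power_sub => // -[//|i] [//|j] a b _ _ eqn Aa Ab.
case: i => [|i] in eqn Aa *.
  case: eqn Ab => -> Ab; apply: (@mem_power_mul 1 n.+1) => //.
  exact: (subvP (IHn n.+1 _)).
have eqn2 : n.+2 = (i.+1 + j.+1)%N by apply: succn_inj; rewrite -eqn.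
rewrite eqn2 mem_power_mul // (subvP (IHn i.+1 _)) //.
by rewrite eqn2 addnS ltnS leq_addr.
Qed.

(** Leading terms multiply: write a = a1 + d and b = b1 + e with a1 in U, b1 in V
and d, e of higher weight.  Then ab = a1 b1 + (a1 e + db), where the last two
products have weight at least i + j + 1. *)
Lemma prods_power_approx U V i j : (0 < i)%N -> (0 < j)%N ->
    (U <= power mul i)%VS -> (power mul i <= U + power mul i.+1)%VS ->
    (power mul j <= V + power mul j.+1)%VS ->
  (prods mul (power mul i) (power mul j) <= prods mul U V + power mul (i + j).+1)%VS.
Proof.
move=> i0 j0 /subvP Ui /subvP approxU /subvP approxV; apply/prodsP => a b Aa Ab.
have /memv_addP[a1 Ua1 [d Ad eq_a]] := approxU a Aa.
have /memv_addP[b1 Vb1 [e Ae eq_b]] := approxV b Ab.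
rewrite eq_a linearDl /= {1}eq_b linearDr /= -addrA.
apply: memv_add; first exact: memv_prods.
apply: memvD; first by rewrite -addnS mem_power_mul ?Ui.
by rewrite -addSn mem_power_mul.
Qed.

(** A subspace containing A^[2] contains all products, so it is closed under
multiplication. *)
Lemma generates_span_add_power2 s :
  generates mul s -> (<<s>> + power mul 2)%VS = fullv.
Proof.
apply=> [a sa | a b _ _]; first by apply: (subvP (addvSl _ _)); apply: memv_span.
by apply: (subvP (addvSr _ _)); apply: (@mem_power_mul 1 1); rewrite ?memvf.
Qed.

(** The Frattini argument.  Let U be a subalgebra with U + A^[2] = A.  Every
A^[i] lies in (U meet A^[i]) + A^[i+1]: the case i = 1 is the assumption, and
leading terms multiply inside U.  Going down the filtration, A = U + A^[i] for
all i, and A^[n] = 0. *)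
Lemma generates_of_span_add_power2 s n :
  (<<s>> + power mul 2)%VS = fullv -> power mul n = 0%VS -> generates mul s.
Proof.
move=> s_gen An0 U sU Umul.
have sUv : (<<s>> <= U)%VS by apply/span_subvP.
have step i : (0 < i)%N -> (power mul i <= (U :&: power mul i) + power mul i.+1)%VS.
  elim/ltn_ind: i => -[|[|i]] // IHi _; first by rewrite power1 capvf -s_gen addvS.
  apply: power_sub => // j k a b j0 k0 eqi Aa Ab.
  have ltj : (j < i.+2)%N by rewrite -eqi -ltn_subLR ?subnn.
  have ltk : (k < i.+2)%N by rewrite -eqi -[k in (k < _)%N]add0n ltn_add2r.
  have UP l : (U :&: power mul l <= power mul l)%VS by apply: capvSr.
  have := memv_prods mul Aa Ab; rewrite -eqi.
  move/(subvP (prods_power_approx j0 k0 (UP j) (IHi j ltj j0) (IHi k ltk k0))).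
  apply/subvP/addvS => //; apply/prodsP => c d /memv_capP[Uc Ac] /memv_capP[Ud Ad].
  by rewrite memv_cap Umul //= mem_power_mul.
have sub i : (fullv <= U + power mul i)%VS.
  elim: i => [|[|i] IHi]; try by rewrite -[X in (_ <= _ + X)%VS]/fullv addvf.
  apply: subv_trans IHi _; rewrite subv_add addvSl /=.
  by apply: subv_trans (step _ _) _ => //; rewrite addvS ?capvSl.
by apply/eqP; rewrite eqEsubv subvf; move: (sub n); rewrite An0 addv0.
Qed.

(** A generating sequence dependent modulo A^[2] could be shortened, by the
Frattini argument. *)
Lemma dim_power2 s n : power mul n = 0%VS -> generates mul s ->
    (forall t, generates mul t -> (size s <= size t)%N) ->
  (size s + \dim (power mul 2))%N = \dim {: A}.
Proof.
move=> An0 s_gen s_min.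
have [t [_ le_ts eq_ts dim_t]] := independent_sublist (power mul 2) s.
rewrite (generates_span_add_power2 s_gen) in eq_ts.
have le_st := s_min t (generates_of_span_add_power2 eq_ts An0).
by rewrite -eq_ts dim_t; congr (_ + _)%N; apply/eqP; rewrite eqn_leq le_st.
Qed.

(** * Associators when the fourth power vanishes *)

Definition associator a b c := (a ⋅ b) ⋅ c - a ⋅ (b ⋅ c).

Lemma associator_linear1 k a a' b c :
  associator (k *: a + a') b c = k *: associator a b c + associator a' b c.
Proof. by rewrite /associator !linearPl /= scalerBr opprD addrACA. Qed.

Lemma associator_linear2 k a b b' c :
  associator a (k *: b + b') c = k *: associator a b c + associator a b' c.
Proof.
by rewrite /associator linearPr linearPl /= linearPl linearPr /= scalerBr opprD addrACA.
Qed.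

Lemma associator_linear3 k a b c c' :
  associator a b (k *: c + c') = k *: associator a b c + associator a b c'.
Proof. by rewrite /associator !linearPr /= scalerBr opprD addrACA. Qed.

Section Class3.
Hypothesis A4 : power mul 4 = 0%VS.

Lemma mul_weight4_eq0 i j a b : (0 < i)%N -> (0 < j)%N -> (i + j)%N = 4%N ->
  a \in power mul i -> b \in power mul j -> a ⋅ b = 0.
Proof.
by move=> i0 j0 ij4 Aa Ab; apply/eqP; rewrite -memv0 -A4 -ij4 mem_power_mul.
Qed.

Lemma mem_mul2 a b : a ⋅ b \in power mul 2.
Proof. by apply: (@mem_power_mul 1 1); rewrite ?memvf. Qed.

Lemma mem_mul3l a b : a \in power mul 2 -> a ⋅ b \in power mul 3.
Proof. by move=> Aa; apply: (@mem_power_mul 2 1); rewrite ?memvf. Qed.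

Lemma mem_mul3r a b : b \in power mul 2 -> a ⋅ b \in power mul 3.
Proof. by move=> Ab; apply: (@mem_power_mul 1 2); rewrite ?memvf. Qed.

Lemma mul3l_eq0 a b : a \in power mul 3 -> a ⋅ b = 0.
Proof. by move=> Aa; apply: (@mul_weight4_eq0 3 1); rewrite ?memvf. Qed.

Lemma mul3r_eq0 a b : b \in power mul 3 -> a ⋅ b = 0.
Proof. by move=> Ab; apply: (@mul_weight4_eq0 1 3); rewrite ?memvf. Qed.

Lemma mul22_eq0 a b : a \in power mul 2 -> b \in power mul 2 -> a ⋅ b = 0.
Proof. by move=> Aa Ab; apply: (@mul_weight4_eq0 2 2). Qed.

(** Here and in the next two lemmas, both terms of the associator have weight at
least 2 + 1 + 1. *)
Lemma associator1_eq0 a b c : a \in power mul 2 -> associator a b c = 0.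
Proof.
move=> Aa; rewrite /associator (mul22_eq0 Aa (mem_mul2 _ _)).
by rewrite (mul3l_eq0 _ (mem_mul3l _ Aa)) subr0.
Qed.

Lemma associator2_eq0 a b c : b \in power mul 2 -> associator a b c = 0.
Proof.
move=> Ab; rewrite /associator (mul3l_eq0 _ (mem_mul3r _ Ab)).
by rewrite (mul3r_eq0 _ (mem_mul3l _ Ab)) subr0.
Qed.

Lemma associator3_eq0 a b c : c \in power mul 2 -> associator a b c = 0.
Proof.
move=> Ac; rewrite /associator (mul22_eq0 (mem_mul2 _ _) Ac).
by rewrite (mul3r_eq0 _ (mem_mul3r _ Ac)) subr0.
Qed.

(** The identity is trilinear and holds trivially, as 0 = 0, when an argument is in
A^[2]; it therefore needs to be checked only on elements spanning A modulo
A^[2].  The arguments are freed from s one after the other. *)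
Lemma pre_lie_of_generators s : (<<s>> + power mul 2)%VS = fullv ->
    (forall a b c, a \in s -> b \in s -> c \in s ->
       associator a b c = associator b a c) ->
  pre_lie mul.
Proof.
move=> s_gen sym.
suff: forall a b c, associator a b c = associator b a c by [].
have ind P := @span_add_ind F A s (power mul 2) P; rewrite s_gen in ind.
have sym3 a b : a \in s -> b \in s -> forall c, associator a b c = associator b a c.
  move=> sa sb c; move: c (memvf c); apply: ind => [k c d Pc Pd | c sc | c Ac].
  - by rewrite !associator_linear3 Pc Pd.
  - exact: sym.
  - by rewrite !associator3_eq0.
have sym2 a : a \in s -> forall b c, associator a b c = associator b a c.
  move=> sa b; move: b (memvf b); apply: ind => [k b d Pb Pd c | b sb c | b Ab c].
  - by rewrite associator_linear1 associator_linear2 Pb Pd.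
  - exact: sym3.
  - by rewrite associator2_eq0 ?associator1_eq0.
move=> a; move: a (memvf a); apply: ind => [k a d Pa Pd b c | a sa b c | a Aa b c].
- by rewrite associator_linear1 associator_linear2 Pa Pd.
- exact: sym2.
- by rewrite associator1_eq0 ?associator2_eq0.
Qed.

(** * Generators of the layers *)

Variables x y : A.

Section Generators.
Hypothesis xy_gen : generates mul [:: x; y].

Lemma power2_eq : power mul 2 = (<<gen_products mul x y>> + power mul 3)%VS.
Proof.
apply/eqP; rewrite eqEsubv subv_add powerS_sub andbT; apply/andP; split.
  have fullE := generates_span_add_power2 xy_gen.
  rewrite powerS // big_nat1.
  rewrite -[X in (_ <= <<X>> + _)%VS]/[seq b ⋅ c | b <- [:: x; y], c <- [:: x; y]].
  by rewrite -prods_span; apply: prods_power_approx; rewrite ?power1 ?fullE ?subvf.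
apply/span_subvP => a; rewrite !inE.
by case/or4P => /eqP->; apply: mem_mul2.
Qed.

Definition cubic_products u := [:: x ⋅ u; y ⋅ u; u ⋅ x; u ⋅ y].

Lemma cubic_products_sub u : u \in power mul 2 ->
  {subset cubic_products u <= power mul 3}.
Proof.
move=> Au a; rewrite !inE.
by case/or4P=> /eqP->; (exact: mem_mul3l) || exact: mem_mul3r.
Qed.

Lemma power3_eq u : power mul 2 = (<[u]> + power mul 3)%VS ->
  power mul 3 = <<cubic_products u>>%VS.
Proof.
move=> A2; have fullE := generates_span_add_power2 xy_gen.
have Au : u \in power mul 2 by rewrite A2 (subvP (addvSl _ _)) ?memv_line.
apply/eqP; rewrite eqEsubv; apply/andP; split; last first.
  by apply/span_subvP; apply: cubic_products_sub.
(* The inclusion is proved modulo A^[4], to apply the rule on leading terms. *)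
rewrite -[<<_>>%VS]addv0 -A4.
have -> : (<<cubic_products u>> =
    prods mul <<[:: x; y]>> <[u]> + prods mul <[u]> <<[:: x; y]>>)%VS.
  by rewrite -span_seq1 !prods_span -span_cat.
have approx1 : (power mul 1 <= <<[:: x; y]>> + power mul 2)%VS by rewrite fullE subvf.
have approx2 : (power mul 2 <= <[u]> + power mul 3)%VS by rewrite -A2.
rewrite powerS // big_ltn // big_nat1 subv_add; apply/andP; split.
  apply: subv_trans (prods_power_approx _ _ _ approx1 approx2) _ => //.
    exact: subvf.
  by rewrite addvS ?addvSl.
apply: subv_trans (prods_power_approx _ _ _ approx2 approx1) _ => //.
by rewrite addvS ?addvSr.
Qed.

End Generators.

(** * The pre-Lie identity in coordinates *)

Section StructureConstants.
Variables u v w : A.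
Hypotheses (Av : v \in power mul 3) (Aw : w \in power mul 3).

(** The v and w components of ij and jk are in A^[3], so a further multiplication
kills them: (ij)k = alpha_ij uk and i(jk) = alpha_jk iu. *)
Lemma associator_coords alpha beta gamma delta nu i j k :
    structure_constants mul x y u v w alpha beta gamma delta nu ->
    i \in [:: x; y] -> j \in [:: x; y] -> k \in [:: x; y] ->
  associator i j k = (alpha i j * delta u k - alpha j k * delta i u) *: v
                     + (alpha i j * nu u k - alpha j k * nu i u) *: w.
Proof.
case=> sc2 sc3 xyi xyj xyk; rewrite /associator (sc2 i j) // (sc2 j k) //.
rewrite !linearDl !linearDr !linearZl_LR !linearZr_LR /=.
rewrite !(mul3l_eq0 _ Av) !(mul3l_eq0 _ Aw) !(mul3r_eq0 _ Av) !(mul3r_eq0 _ Aw).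
rewrite !scaler0 !addr0 (sc3 u k); last by left.
rewrite (sc3 i u); last by right.
by rewrite !scalerDr opprD addrACA !scalerA -!scalerBl.
Qed.

(** Symmetry at (x, y, x) gives the first two equations and symmetry at (y, x, y)
the last two; the other triples are trivial or mirror images of these. *)
Lemma associator_symP alpha beta gamma delta nu : free [:: v; w] ->
    structure_constants mul x y u v w alpha beta gamma delta nu ->
  (forall a b c, a \in [:: x; y] -> b \in [:: x; y] -> c \in [:: x; y] ->
     associator a b c = associator b a c) <->
  [/\ alpha x y * delta u x - alpha y x * delta x u
        = alpha y x * delta u x - alpha x x * delta y u,
      alpha x y * nu u x - alpha y x * nu x u
        = alpha y x * nu u x - alpha x x * nu y u,
      alpha y x * delta u y - alpha x y * delta y u
        = alpha x y * delta u y - alpha y y * delta x u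
    & alpha y x * nu u y - alpha x y * nu y u
        = alpha x y * nu u y - alpha y y * nu x u].
Proof.
move=> fr sc.
have xx : x \in [:: x; y] by rewrite mem_head.
have yy : y \in [:: x; y] by rewrite !inE eqxx orbT.
split=> [sym | [ex1 ex2 ey1 ey2] a b c].
  have := sym x y x xx yy xx; rewrite !(associator_coords sc) //.
  case/(free_pair_inj fr) => ex1 ex2.
  have := sym y x y yy xx yy; rewrite !(associator_coords sc) //.
  by case/(free_pair_inj fr).
rewrite !inE => /orP[]/eqP-> /orP[]/eqP-> /orP[]/eqP-> //;
  by rewrite !(associator_coords sc) // ?ex1 ?ex2 ?ey1 ?ey2.
Qed.

Lemma structure_constants_exist :
    (forall a b, a ⋅ b \in (<[u]> + (<[v]> + <[w]>))%VS) ->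
    (forall k l, k = u /\ l \in [:: x; y] \/ k \in [:: x; y] /\ l = u ->
       k ⋅ l \in (<[v]> + <[w]>)%VS) ->
  exists alpha beta gamma delta nu,
    structure_constants mul x y u v w alpha beta gamma delta nu.
Proof.
move=> mul2 mul3.
pose c3 i a b := coord [tuple u; v; w] i (a ⋅ b).
pose c2 i a b := coord [tuple v; w] i (a ⋅ b).
exists (c3 ord0), (c3 (lift ord0 ord0)), (c3 (lift ord0 (lift ord0 ord0))).
exists (c2 ord0), (c2 (lift ord0 ord0)).
split=> [a b _ _ | k l kl].
  have /coord_span {1}-> : a ⋅ b \in <<[tuple u; v; w]>>%VS.
    by rewrite !span_cons span_nil addv0.
  by rewrite !big_ord_recl big_ord0 addr0 addrA.
have /coord_span {1}-> : k ⋅ l \in <<[tuple v; w]>>%VS.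
  by rewrite !span_cons span_nil addv0 mul3.
by rewrite !big_ord_recl big_ord0 addr0.
Qed.

End StructureConstants.

Lemma gen_products_sub2 : {subset gen_products mul x y <= power mul 2}.
Proof. by move=> a; rewrite !inE => /or4P[] /eqP->; apply: mem_mul2. Qed.

Lemma adapted_basis_free u v w : adapted_basis mul x y u v w -> free [:: v; w].
Proof.
by case=> /basis_free + _ _ _ _; rewrite -[[:: x; y; _; _; _]]/([:: x; y; u] ++ [:: v; w])
  => /catr_free.
Qed.

Lemma adapted_basis_mem3 u v w : adapted_basis mul x y u v w ->
  v \in power mul 3 /\ w \in power mul 3.
Proof.
by case=> _ /gen_products_sub2 Au _ Tv Tw; split; apply: (cubic_products_sub Au).
Qed.

(** * Adapted bases *)

Section TwoGenerated.
Hypotheses (xy_gen : generates mul [:: x; y]) (dimA2 : \dim (power mul 2) = 3%N)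
  (dimA3 : \dim (power mul 3) = 2%N).

(** A^[3] is a hyperplane of A^[2]. *)
Lemma power2_line u : u \in power mul 2 -> u \notin power mul 3 ->
  power mul 2 = (<[u]> + power mul 3)%VS.
Proof.
move=> Au nAu; apply/esym/eqP.
by rewrite eqEdim subv_add -memvE Au powerS_sub dim_line_add // dimA2 dimA3.
Qed.

Lemma products_not_all_in_power3 : ~ {subset gen_products mul x y <= power mul 3}.
Proof.
move/span_subvP => sub; have : \dim (power mul 2) = \dim (power mul 3).
  by rewrite (power2_eq xy_gen); congr (\dim _); apply/addv_idPr.
by rewrite dimA2 dimA3.
Qed.

Lemma adapted_basis_exists : \dim {: A} = 5%N ->
  exists u v w, adapted_basis mul x y u v w.
Proof.
move=> dimA.
have [/allP/products_not_all_in_power3 // | /allPn[u Su nAu]] :=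
  boolP (all [in power mul 3] (gen_products mul x y)).
have A2 := power2_line (gen_products_sub2 Su) nAu.
have A3 := power3_eq xy_gen A2.
(* Among the four products, two independent ones span A^[3]. *)
have [t [sub_t _]] := independent_sublist 0%VS (cubic_products u).
rewrite !addv0 dimv0 addn0 => eq_t; rewrite eq_t -A3 dimA3.
case: t => [|v [|w [|? ?]]] // in sub_t eq_t * => _.
exists u, v, w; split=> //; last 2 first.
- by apply: sub_t; rewrite mem_head.
- by apply: sub_t; rewrite !inE eqxx orbT.
rewrite basisEdim dimA andbT -(generates_span_add_power2 xy_gen).
by rewrite A2 A3 -eq_t -span_cons -span_cat.
Qed.

Lemma adapted_basis_power_spans u v w :
  adapted_basis mul x y u v w -> power_spans mul u v w.
Proof.
move=> ad; have fr := adapted_basis_free ad; have [Av Aw] := adapted_basis_mem3 ad.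
case: ad => _ /gen_products_sub2 Au nAu _ _; split; last exact: power2_line.
apply/esym/eqP; rewrite eqEdim subv_add -!memvE Av Aw dimA3 /=.
by move: fr; rewrite /free span_cons span_seq1 => /eqP->.
Qed.

Lemma adapted_basis_structure_relations u v w : pre_lie mul ->
  adapted_basis mul x y u v w -> structure_relations mul x y u v w.
Proof.
move=> preL ad; have [A3 A2] := adapted_basis_power_spans ad.
have fr := adapted_basis_free ad; have [Av Aw] := adapted_basis_mem3 ad.
case: ad => _ Su nAu _ _; have Au := gen_products_sub2 Su.
split.
  apply: structure_constants_exist => [a b | k l].
    by rewrite -A3 -A2 mem_mul2.
  by rewrite -A3 => -[[-> _] | [_ ->]]; [exact: mem_mul3l | exact: mem_mul3r].
move=> alpha beta gamma delta nu sc.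
have /(associator_symP Av Aw fr sc)[] // :
    forall a b c, a \in [:: x; y] -> b \in [:: x; y] -> c \in [:: x; y] ->
     associator a b c = associator b a c by move=> a b c _ _ _; apply: preL.
(* If all alpha vanish, then S lies in A^[3], and so does u. *)
split=> // alpha0; case/negP: nAu.
have sub i j : i \in [:: x; y] -> j \in [:: x; y] -> i ⋅ j \in power mul 3.
  by move=> xyi xyj; rewrite (sc.1 i j) // alpha0 // scale0r add0r memvD ?memvZ.
have xx : x \in [:: x; y] by rewrite mem_head.
have yy : y \in [:: x; y] by rewrite !inE eqxx orbT.
by move: Su; rewrite !inE => /or4P[]/eqP->; apply: sub.
Qed.

End TwoGenerated.

Lemma pre_lie_of_structure_relations u v w : generates mul [:: x; y] ->
    adapted_basis mul x y u v w -> structure_relations mul x y u v w ->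
  pre_lie mul.
Proof.
move=> xy_gen ad [[alpha [beta [gamma [delta [nu sc]]]]]].
move=> /(_ _ _ _ _ _ sc)[_ e1 e2 e3 e4].
have [Av Aw] := adapted_basis_mem3 ad.
apply: (pre_lie_of_generators (generates_span_add_power2 xy_gen)).
by apply/(associator_symP Av Aw (adapted_basis_free ad) sc).
Qed.

End Class3.
End Algebra.

Theorem theorem5p2p1 (p : nat) (p_prime : prime p) :
  (forall (A : vectType 'F_p) (mul : {bilinear A -> A -> A}) (x y : A),
     pre_lie mul ->
     \dim {: A} = 5%N ->
     generates mul [:: x; y] ->
     (forall s : seq A, generates mul s -> (2 <= size s)%N) ->
     power mul 3 <> 0%VS ->
     power mul 4 = 0%VS ->
     \dim (power mul 3) = 2%N ->
     [/\ products_not_in_power3 mul x y,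
         exists u v w : A, adapted_basis mul x y u v w
       & forall u v w : A, adapted_basis mul x y u v w ->
           power_spans mul u v w /\ structure_relations mul x y u v w])
  /\
  (forall (A : vectType 'F_p) (mul : {bilinear A -> A -> A}) (x y : A),
     \dim {: A} = 5%N ->
     generates mul [:: x; y] ->
     power mul 3 <> 0%VS ->
     power mul 4 = 0%VS ->
     \dim (power mul 3) = 2%N ->
     products_not_in_power3 mul x y ->
     (exists u v w : A,
        [/\ adapted_basis mul x y u v w, power_spans mul u v w & structure_relations mul x y u v w]) ->
     pre_lie mul).
Proof.
split=> [A mul x y preL dimA xy_gen xy_min _ A4 dimA3 |
         A mul x y dimA xy_gen _ A4 _ _ [u [v [w [ad _ sr]]]]].
  have dimA2 : \dim (power mul 2) = 3%N.
    by have /eqP := dim_power2 A4 xy_gen xy_min; rewrite dimA => /eqP[].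
  split=> [||u v w ad].
  - exact: (products_not_all_in_power3 xy_gen dimA2 dimA3).
  - exact: (adapted_basis_exists A4 xy_gen dimA2 dimA3 dimA).
  split; first exact: (adapted_basis_power_spans dimA2 dimA3 ad).
  exact: (adapted_basis_structure_relations A4 dimA2 dimA3 preL ad).
exact: (pre_lie_of_structure_relations A4 xy_gen ad sr).
Qed.
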